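(* Let $G=(V,b,m)$ be a weighted graph and let $\tilde G=(\tilde V,\tilde b,\tilde m)$ be a model graph with root $o$. Suppose that $G$ has stronger curvature growth than $\tilde G$ outside a finite set, with respect to a vertex $x_0\in V$, and that $m(S_r(x_0))\le C\,\tilde m(S_r(o))$ for some $C>0$ and all $r$ large enough. If $\tilde G$ is not $L^1$-Liouville, then $G$ is not $L^1$-Liouville.
   Context: A (weighted) graph is a triple $G=(V,b,m)$, where $V$ is the set of vertices, $b:V\times V\to[0,\infty)$ is symmetric and vanishes on the diagonal, and $m:V\to(0,\infty)$. Write $x\sim y$ if $b(x,y)\neq 0$. All graphs are assumed connected (any two vertices are joined by a finite path of neighbors $x=z_0\sim z_1\sim\dots\sim z_n=y$) and locally finite ($\{y: b(x,y)\ne 0\}$ is finite for every $x$). $d(x,y)$ is the combinatorial distance (minimal number of edges in a path from $x$ to $y$). For $A\subset V$, $m(A)=\sum_{x\in A}m(x)$. The Laplacian is $\Delta f(x)=\frac1{m(x)}\sum_{y\in V}b(x,y)(f(x)-f(y))$ for $f:V\to\mathbb R$ (positive sign convention). $L^1(V,m)$ is the set of functions $u$ on $V$ with $\sum_{x\in V}|u(x)|m(x)<\infty$. A graph is $L^1$-Liouville if every non-negative $u\in L^1(V,m)$ with $\Delta u\ge 0$ on $V$ is constant. For a fixed vertex $x_0$ put $S_r(x_0)=\{y: d(x_0,y)=r\}$. For $x\in S_r(x_0)$ the outer and inner curvatures (with respect to $x_0$) are $k_{\pm}(x)=\frac1{m(x)}\sum_{y\in S_{r\pm1}(x_0)}b(x,y)$.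 A graph is a model graph with root $o$ if, for every $r\ge 0$, its curvatures with respect to $o$ are constant on $S_r(o)$; for a model $\tilde G$ these constants are denoted $\tilde k_\pm(r)$. $G$ has stronger curvature growth than a model $\tilde G$ outside a finite set if there exist a vertex $x_0\in V$ and $R\ge 0$ such that $k_+(x)\ge\tilde k_+(r)$ and $k_-(x)\le\tilde k_-(r)$ for all $x\in S_r(x_0)$ with $r\ge R$ (curvatures of $G$ taken with respect to $x_0$).
   Formalization: The vertex set V of G is assumed infinite; for finite G the comparison conditions hold vacuously for large r while G is always L^1-Liouville, so the claim as worded fails (e.g. G a single vertex). *)

(* Defs.v *)
From HB Require Import structures.
From mathcomp Require Import all_boot all_order all_algebra.
From mathcomp Require Import all_classical all_reals all_analysis.

Set Implicit Arguments.
Unset Strict Implicit.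
Unset Printing Implicit Defensive.

Import Order.TTheory GRing.Theory Num.Theory.

Local Open Scope classical_set_scope.
Local Open Scope ring_scope.

Definition joined (V : choiceType) (e : rel V) (n : nat) (x y : V) : Prop :=
  exists s : seq V, [/\ size s = n, path e x s & last x s = y].

Record wgraph (R : realType) (V : choiceType) := WGraph {
  gb : V -> V -> R;
  gm : V -> R;
  gb_ge0 : forall x y, 0 <= gb x y;
  gb_sym : forall x y, gb x y = gb y x;
  gb_diag : forall x, gb x x = 0;
  gm_gt0 : forall x, 0 < gm x;
  g_connected :
    forall x y, exists n, joined (fun x y => gb x y != 0) n x y;
  g_locfin : forall x, finite_set [set y | gb x y != 0] }.

Definition adj (R : realType) (V : choiceType) (G : wgraph R V) : rel V :=
  fun x y => gb G x y != 0.

Lemma ex_joined (R : realType) (V : choiceType) (G : wgraph R V) (x y : V) :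
  exists n, `[< joined (adj G) n x y >].
Proof. by have [n xy] := g_connected G x y; exists n; apply/asboolP. Qed.

Definition dist (R : realType) (V : choiceType) (G : wgraph R V) (x y : V)
  : nat := ex_minn (ex_joined G x y).

Definition sphere (R : realType) (V : choiceType) (G : wgraph R V) (x0 : V)
  (r : nat) : set V := [set y | dist G x0 y = r].

Definition gmeas (R : realType) (V : choiceType) (G : wgraph R V) (A : set V)
  : \bar R := \esum_(x in A) (gm G x)%:E.

(* The fsbigop sum would be 0 on a summand of infinite support; here, and in
   the curvatures below, the support is finite by local finiteness. *)
Definition laplacian (R : realType) (V : choiceType) (G : wgraph R V)
  (f : V -> R) (x : V) : R :=
  (gm G x)^-1 * \sum_(y \in [set: V]) gb G x y * (f x - f y).

Definition in_L1 (R : realType) (V : choiceType) (G : wgraph R V)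
  (u : V -> R) : Prop :=
  (\esum_(x in [set: V]) (`|u x| * gm G x)%:E < +oo)%E.

Definition L1_Liouville (R : realType) (V : choiceType) (G : wgraph R V)
  : Prop :=
  forall u : V -> R, (forall x, 0 <= u x) -> in_L1 G u ->
    (forall x, 0 <= laplacian G u x) -> exists c, forall x, u x = c.

Definition kplus (R : realType) (V : choiceType) (G : wgraph R V) (x0 x : V)
  : R :=
  (gm G x)^-1 * \sum_(y \in sphere G x0 (dist G x0 x).+1) gb G x y.

(* The index set is S_(r-1)(x0) for r = d(x0, x); writing d(x0, y) + 1 = r
   makes it empty, as it should be, when r = 0. *)
Definition kminus (R : realType) (V : choiceType) (G : wgraph R V) (x0 x : V)
  : R :=
  (gm G x)^-1 *
  \sum_(y \in [set y | (dist G x0 y).+1 = dist G x0 x]) gb G x y.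

(* G is a model with root o, and kp r, km r are the constant values of its
   outer and inner curvatures on S_r(o). *)
Definition is_model (R : realType) (V : choiceType) (G : wgraph R V) (o : V)
  (kp km : nat -> R) : Prop :=
  forall r x, sphere G o r x -> kplus G o x = kp r /\ kminus G o x = km r.

(* kp and km stand for the curvatures of the model G is compared with. *)
Definition stronger_curvature_growth (R : realType) (V : choiceType)
  (G : wgraph R V) (x0 : V) (kp km : nat -> R) : Prop :=
  exists r0 : nat, forall r x, (r0 <= r)%N -> sphere G x0 r x ->
    kp r <= kplus G x0 x /\ kminus G x0 x <= km r.

(* Main.v *)
(* On a model graph, the averages rho(r) of a superharmonic u over the spheres
   around the root are again superharmonic: they are nonincreasing, and
   k+(r) (rho(r) - rho(r+1)) >= k-(r) (rho(r-1) - rho(r)).  Replacing a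
   nonconstant u by min (u, u(o)) makes rho eventually strictly decreasing.
   For N large, rho (max (d (x0, x), N)) is then superharmonic on G, because the
   stronger curvature growth only helps when rho decreases; it is nonconstant,
   and integrable by the comparison of the measures of the spheres. *)
Require Import Defs.
From HB Require Import structures.
From mathcomp Require Import all_boot all_order all_algebra.
From mathcomp Require Import all_classical all_reals all_analysis.
From mathcomp Require Import finmap lra.

Set Implicit Arguments.
Unset Strict Implicit.
Unset Printing Implicit Defensive.

Import Order.TTheory GRing.Theory Num.Theory.

Local Open Scope classical_set_scope.
Local Open Scope ring_scope.

Section Graph.
Variables (R : realType) (V : choiceType) (G : wgraph R V) (x0 : V).

Local Notation d := (dist G x0).

(** * Distance to the root and finiteness of balls *)

Lemma dist_joined (x y : V) : joined (adj G) (dist G x y) x y.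
Proof. by rewrite /dist; case: ex_minnP => n /asboolP. Qed.

Lemma dist_min (x y : V) (n : nat) :
  joined (adj G) n x y -> (dist G x y <= n)%N.
Proof.
by rewrite /dist => xyn; case: ex_minnP => k _; apply; apply/asboolP.
Qed.

Lemma adj_sym (x y : V) : adj G x y = adj G y x.
Proof. by rewrite /adj gb_sym. Qed.

Lemma dist_adj_le (x y : V) : adj G x y -> (d y <= (d x).+1)%N.
Proof.
move=> xy; have [s [<- s_path s_last]] := dist_joined x0 x.
apply: dist_min; exists (rcons s y).
by rewrite size_rcons rcons_path s_path s_last last_rcons.
Qed.

(** The witness [y] is the last vertex before [x] on a shortest path from [x0]. *)
Lemma dist_pred (x : V) (r : nat) :
  d x = r.+1 -> exists2 y, adj G y x & d y = r.
Proof.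
move=> dx; have [s []] := dist_joined x0 x; rewrite dx.
elim/last_ind: s => // s z _; rewrite size_rcons rcons_path last_rcons.
move=> [sr] /andP[s_path adj_z] zx; rewrite zx in adj_z.
exists (last x0 s) => //; apply/eqP; rewrite eqn_leq; apply/andP; split.
  by apply: dist_min; exists s.
by rewrite -ltnS -dx; apply: dist_adj_le.
Qed.

Lemma sphere_le (r n : nat) :
  (r <= n)%N -> sphere G x0 n !=set0 -> sphere G x0 r !=set0.
Proof.
move=> /subnK <-; elim: (n - r)%N => // k ih [x /dist_pred[y _ dy]].
by apply: ih; exists y.
Qed.

(** By induction on [n]: a vertex at distance [n.+1] is a neighbour of the previous ball, and local
    finiteness leaves finitely many of these. *)
Lemma finite_ball (n : nat) : finite_set [set x | (d x <= n)%N].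
Proof.
elim: n => [|n ih].
  apply: (@sub_finite_set _ _ [set x0]) => // x /=.
  rewrite leqn0 => /eqP dx; have [s [/eqP]] := dist_joined x0 x.
  by rewrite dx size_eq0 => /eqP -> _ <-.
apply: (@sub_finite_set _ _ ([set x | (d x <= n)%N] `|`
  \bigcup_(x in [set x | (d x <= n)%N]) [set y | gb G x y != 0])).
  move=> x /=; rewrite leq_eqVlt => /orP[/eqP/dist_pred[y yx dy]|dx].
    by right; exists y => //=; rewrite dy.
  by left.
rewrite finite_setU; split=> //.
by apply: bigcup_finite => // x _; exact: g_locfin.
Qed.

(** * Finite sums over balls and spheres *)

Definition ball (n : nat) : {fset V} := fset_set [set x | (d x <= n)%N].

Lemma in_ball (n : nat) (x : V) : (x \in ball n) = (d x <= n)%N.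
Proof.
rewrite in_fset_set; last exact: finite_ball.
by apply/idP/idP => [/set_mem|/mem_set].
Qed.

(** Were the sphere empty, so would be all larger ones, and the whole graph would be a finite
    ball. *)
Lemma infinite_sphere (r : nat) :
  infinite_set [set: V] -> sphere G x0 r !=set0.
Proof.
move=> Vinf; apply: contrapT => r0; apply: Vinf.
apply: (sub_finite_set _ (finite_ball r)) => x _ /=.
by rewrite leqNgt; apply/negP => /ltnW rd; apply/r0/(sphere_le rd); exists x.
Qed.

Lemma ball_sum (n r : nat) (F : V -> R) : (r <= n)%N ->
  \sum_(x <- ball n | (d x <= r)%N) F x = \sum_(x <- ball r) F x.
Proof.
move=> rn; rewrite -[LHS]big_filter.
apply: perm_big; apply: uniq_perm; rewrite ?filter_uniq ?fset_uniq// => x.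
rewrite mem_filter !in_ball.
by case dxr : (_ <= r)%N => //=; apply: leq_trans rn.
Qed.

Lemma ball_sphere_sum (n r : nat) (F : V -> R) : (r <= n)%N ->
  \sum_(x <- ball n | d x == r) F x = \sum_(x <- ball r | d x == r) F x.
Proof.
move=> rn; rewrite [RHS]big_mkcond -(ball_sum _ rn) -big_mkcondr.
by apply: eq_bigl => x; case: eqP => [->|]; rewrite ?leqnn ?andbF.
Qed.

Definition sphere_sum (F : V -> R) (r : nat) : R :=
  \sum_(x <- ball r | d x == r) F x.

Lemma ball_sumS (n : nat) (F : V -> R) :
  \sum_(x <- ball n.+1) F x = \sum_(x <- ball n) F x + sphere_sum F n.+1.
Proof.
rewrite (bigID (fun x => (d x <= n)%N)) /= ball_sum//; congr (_ + _).
rewrite /sphere_sum big_seq_cond [RHS]big_seq_cond; apply: eq_bigl => x.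
by rewrite in_ball -ltnNge -eqn_leq; case: eqP => [->|]; rewrite ?leqnn ?andbF.
Qed.

Lemma sphere_sum_gt0 (F : V -> R) (r : nat) :
  (forall x, 0 < F x) -> sphere G x0 r !=set0 -> 0 < sphere_sum F r.
Proof.
move=> F0 [x dx]; rewrite /sphere_sum big_mkcond.
rewrite (bigD1_seq x) ?fset_uniq ?in_ball ?dx//= eqxx.
by rewrite ltr_wpDr// sumr_ge0// => y _; case: ifP => // _; exact: ltW.
Qed.

Lemma sphere_sumD (E F : V -> R) (r : nat) :
  sphere_sum (fun x => E x + F x) r = sphere_sum E r + sphere_sum F r.
Proof. exact: big_split. Qed.

Lemma sphere_sumM (a : R) (F : V -> R) (r : nat) :
  sphere_sum (fun x => a * F x) r = a * sphere_sum F r.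
Proof. by rewrite /sphere_sum mulr_sumr. Qed.

Lemma eq_sphere_sum (E F : V -> R) (r : nat) :
  (forall x, d x = r -> E x = F x) -> sphere_sum E r = sphere_sum F r.
Proof. by move=> EF; apply: eq_bigr => x /eqP; exact: EF. Qed.

Lemma le_sphere_sum (E F : V -> R) (r : nat) :
  (forall x, d x = r -> E x <= F x) -> sphere_sum E r <= sphere_sum F r.
Proof. by move=> EF; apply: ler_sum => x /eqP; exact: EF. Qed.

Lemma gmeas_sphere (r : nat) :
  gmeas G (sphere G x0 r) = (sphere_sum (gm G) r)%:E.
Proof.
have fin : finite_set (sphere G x0 r).
  by apply: (sub_finite_set _ (finite_ball r)) => x /= ->.
rewrite /gmeas esum_fset//; last by move=> x _; rewrite lee_fin ltW ?gm_gt0.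
rewrite fsumEFin//; congr (_%:E); rewrite /sphere_sum [RHS]bigfs ?fset_uniq//.
  by apply: eq_fsbigl; apply/seteqP; split=> x /= /eqP.
by move=> x /eqP dx; rewrite in_ball dx leqnn.
Qed.

(** * Laplacian and curvatures as finite sums *)

Definition nbrs (x : V) : {fset V} := fset_set [set y | gb G x y != 0].

Lemma in_nbrs (x y : V) : (y \in nbrs x) = adj G x y.
Proof.
rewrite in_fset_set; last exact: g_locfin.
by apply/idP/idP => [/set_mem|/mem_set].
Qed.

Lemma notin_nbrs (x y : V) : y \notin nbrs x -> gb G x y = 0.
Proof. by rewrite in_nbrs negbK => /eqP. Qed.

(** The freedom in [s] lets one ball serve as index set for all vertices of a smaller ball, so that
    double sums can be exchanged. *)
Lemma gm_laplacian (f : V -> R) (x : V) (s : seq V) :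
    uniq s -> {subset nbrs x <= s} ->
  gm G x * laplacian G f x = \sum_(y <- s) gb G x y * (f x - f y).
Proof.
move=> us xs; rewrite /laplacian mulVKf ?gt_eqF ?gm_gt0//.
rewrite [RHS]bigfs//; first by apply: eq_fsbigl; apply/seteqP.
by move=> y _ /(contra (@xs y))/notin_nbrs ->; rewrite mul0r.
Qed.

Lemma gm_kplus (x : V) (s : seq V) : uniq s -> {subset nbrs x <= s} ->
  gm G x * kplus G x0 x = \sum_(y <- s | d y == (d x).+1) gb G x y.
Proof.
move=> us xs; rewrite /kplus mulVKf ?gt_eqF ?gm_gt0//.
rewrite [RHS]bigfs//; first by apply: eq_fsbigl; apply/seteqP; split=> y /eqP.
by move=> y _ /(contra (@xs y))/notin_nbrs ->.
Qed.

Lemma gm_kminus (x : V) (s : seq V) : uniq s -> {subset nbrs x <= s} ->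
  gm G x * kminus G x0 x = \sum_(y <- s | (d y).+1 == d x) gb G x y.
Proof.
move=> us xs; rewrite /kminus mulVKf ?gt_eqF ?gm_gt0//.
rewrite [RHS]bigfs//; first by apply: eq_fsbigl; apply/seteqP; split=> y /eqP.
by move=> y _ /(contra (@xs y))/notin_nbrs ->.
Qed.

(** Neighbours of [x] lie on its own sphere, where the difference vanishes, or on the two adjacent
    ones. At [d x = 0] the truncated predecessor is harmless: the inner difference is then zero. *)
Lemma laplacian_radial (phi : nat -> R) (x : V) :
  laplacian G (phi \o d) x =
  kplus G x0 x * (phi (d x) - phi (d x).+1) +
  kminus G x0 x * (phi (d x) - phi (d x).-1).
Proof.
have m0 : gm G x != 0 by rewrite gt_eqF ?gm_gt0.
apply: (mulfI m0).
rewrite mulrDr (mulrA _ (kplus _ _ _)) (mulrA _ (kminus _ _ _)).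
rewrite (@gm_laplacian _ _ (nbrs x)) ?fset_uniq//.
rewrite (@gm_kplus _ (nbrs x)) ?fset_uniq//.
rewrite (@gm_kminus _ (nbrs x)) ?fset_uniq//.
rewrite !mulr_suml !(big_mkcond (fun y => d y == _)).
rewrite !(big_mkcond (fun y => _.+1 == _)) -big_split/=.
rewrite big_seq [RHS]big_seq; apply: eq_bigr => y; rewrite in_nbrs => xy.
have := dist_adj_le xy; rewrite adj_sym in xy; have := dist_adj_le xy.
case: eqP => [->|/eqP ne1] le1 le2.
  by rewrite gtn_eqF ?addr0// ltnS ltnW.
case: eqP => [<-|/eqP ne2]; first by rewrite add0r.
have -> : d y = d x; last by rewrite subrr mulr0 addr0.
apply/eqP; rewrite eqn_leq -ltnS ltn_neqAle ne1 le2/=.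
by rewrite -ltnS ltn_neqAle eq_sym ne2.
Qed.

(** If [f x <= c], truncation keeps the value at [x] and can only lower those around it; otherwise
    [x] is a maximum of the truncated function. *)
Lemma laplacian_min (f : V -> R) (c : R) (x : V) :
    0 <= laplacian G f x ->
  0 <= laplacian G (fun y => Num.min (f y) c) x.
Proof.
have m0 := gm_gt0 G x.
rewrite -(pmulr_rge0 _ m0) -(pmulr_rge0 (laplacian _ (fun=> _) _) m0).
rewrite !(@gm_laplacian _ _ (nbrs x)) ?fset_uniq// => f0.
have [fxc|cfx] := leP (f x) c.
  apply: le_trans f0 _; apply: ler_sum => y _.
  by rewrite ler_wpM2l ?gb_ge0// lerB// ge_min lexx.
apply: sumr_ge0 => y _.
by rewrite mulr_ge0 ?gb_ge0// subr_ge0 ge_min lexx orbT.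
Qed.

(** Every finite set of vertices lies in some ball, so bounding the sums over balls bounds all
    finite sums. *)
Lemma in_L1P (u : V -> R) : (forall x, 0 <= u x) ->
  in_L1 G u <-> exists K, forall n, \sum_(x <- ball n) u x * gm G x <= K.
Proof.
move=> u0; have um0 x : 0 <= u x * gm G x by rewrite mulr_ge0// ltW ?gm_gt0.
rewrite /in_L1; split=> [uL1|[K uK]].
  set S := (\esum_(x in _) _)%E in uL1.
  have S0 : (0 <= S)%E by apply: esum_ge0 => x _; rewrite lee_fin ger0_norm.
  exists (fine S) => n; rewrite -lee_fin fineK ?ge0_fin_numE//.
  apply: esum_ge; exists [set x | (d x <= n)%N].
    by split=> //; exact: finite_ball.
  rewrite fsbig_finite; last exact: finite_ball.
  by rewrite -sumEFin; apply: lee_sum => x _; rewrite ger0_norm.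
apply: (@le_lt_trans _ _ K%:E); last exact: ltry.
apply: ge_ereal_sup => _ [X [finX _] <-].
have [n Xn] : exists n, X `<=` [set` ball n].
  exists (\max_(x <- fset_set X) d x)%N => x Xx /=; rewrite in_ball.
  by apply: (@leq_bigmax_seq _ _ xpredT) => //; rewrite in_fset_set// mem_set.
apply: le_trans (_ : (\sum_(x <- ball n) u x * gm G x)%:E <= _)%E; last first.
  by rewrite lee_fin.
rewrite fsbig_mkcond (fsbigTE (ball n)); last first.
  by move=> x; rewrite patchE; case: ifPn => // /set_mem/Xn/= ->.
rewrite -sumEFin; apply: lee_sum => x _; rewrite patchE; case: ifP => _.
  by rewrite ger0_norm.
by rewrite lee_fin.
Qed.

(* Interior edges of the ball cancel, so only the edges between the spheres
   of radii r and r + 1 contribute. *)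
Lemma ball_laplacian (kp km : nat -> R) (f : V -> R) (r : nat) :
    is_model G x0 kp km ->
  \sum_(x <- ball r) gm G x * laplacian G f x =
  kp r * sphere_sum (fun x => f x * gm G x) r -
  km r.+1 * sphere_sum (fun x => f x * gm G x) r.+1.
Proof.
(* Radius [r.+2] captures every neighbour of the spheres of radii [r] and [r.+1]. *)
move=> model; pose s := ball r.+2; pose g x y := gb G x y * (f x - f y).
have us : uniq s by exact: fset_uniq.
have nbrs_s x : (d x <= r.+1)%N -> {subset nbrs x <= s}.
  move=> dx y; rewrite in_nbrs in_ball => /dist_adj_le dy.
  exact: leq_trans dy _.
have split_r : \sum_(x <- ball r) gm G x * laplacian G f x =
    \sum_(x <- s | (d x <= r)%N) \sum_(y <- s | ~~ (d y <= r)%N) g x y.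
  rewrite -(@ball_sum r.+2) ?leqW//.
  transitivity (\sum_(x <- s | (d x <= r)%N) \sum_(y <- s) g x y).
    by apply: eq_bigr => x dx; rewrite (gm_laplacian _ us)//; apply/nbrs_s/leqW.
  under eq_bigr => x _ do rewrite (bigID (fun y => (d y <= r)%N))/=.
  rewrite big_split/= -[RHS]add0r; congr (_ + _).
  (* [g] is antisymmetric, so exchanging the two sums over the ball negates [T]. *)
  set T := (X in X = 0); suff : T = - T by move=> TN; lra.
  rewrite /T {1}exchange_big/= -sumrN; apply: eq_bigr => x _.
  rewrite -sumrN; apply: eq_bigr => y _.
  by rewrite /g gb_sym -mulrN opprB.
(* Distance grows by at most one along an edge, so edges leave the ball only from its outermost
   sphere. *)
have cross x y : (d x <= r)%N -> ~~ (d y <= r)%N -> 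
    ~~ ((d x == r) && (d y == r.+1)) -> gb G x y = 0.
  move=> dx dy; apply: contraNeq => /dist_adj_le xy; rewrite -ltnNge in dy.
  have dxr : d x = r.
    by apply/eqP; rewrite eqn_leq dx -ltnS (leq_trans dy).
  by rewrite dxr eqxx eqn_leq dy -dxr xy.
have split_S : \sum_(x <- ball r) gm G x * laplacian G f x =
    \sum_(x <- s | d x == r) \sum_(y <- s | d y == r.+1) g x y.
  rewrite split_r big_mkcond [RHS]big_mkcond; apply: eq_bigr => x _.
  case: ifPn => dx; last by case: eqP dx => // ->; rewrite leqnn.
  case: eqP => dxr.
    rewrite big_mkcond [RHS]big_mkcond; apply: eq_bigr => y _.
    case: ifPn => dy; last by case: eqP dy => // ->; rewrite ltnn.
    case: eqP => // dyr; rewrite /g cross ?mul0r//.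
    by rewrite negb_and; move/eqP : dyr => ->; rewrite orbT.
  rewrite big1// => y dy; rewrite /g cross ?mul0r//.
  by rewrite negb_and; move/eqP : dxr => ->.
rewrite split_S.
under eq_bigr => x _ do
  (under eq_bigr => y _ do rewrite /g mulrBr; rewrite sumrB).
rewrite sumrB; congr (_ - _).
  rewrite -sphere_sumM /sphere_sum -(@ball_sphere_sum r.+2) ?leqW//.
  apply: eq_bigr => x /eqP dx; rewrite -mulr_suml.
  have [<- _] := model _ _ dx.
  rewrite mulrC [RHS]mulrCA; congr (_ * _).
  rewrite [RHS]mulrC (gm_kplus us) ?dx//.
  by apply: nbrs_s; rewrite dx.
rewrite -sphere_sumM /sphere_sum -(@ball_sphere_sum r.+2)//.
rewrite exchange_big/=; apply: eq_bigr => y /eqP dy; rewrite -mulr_suml.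
have [_ <-] := model _ _ dy.
rewrite mulrC [RHS]mulrCA; congr (_ * _).
rewrite [RHS]mulrC (gm_kminus us); last first.
  by apply: nbrs_s; rewrite dy.
by apply: eq_big => x; rewrite ?dy // gb_sym.
Qed.

Lemma kplus_ge0 (x : V) : 0 <= kplus G x0 x.
Proof.
rewrite mulr_ge0 ?invr_ge0 ?(ltW (gm_gt0 _ _))//.
by apply: sumr_ge0 => y _; exact: gb_ge0.
Qed.

(** The predecessor of [x] on a shortest path contributes a positive weight. *)
Lemma kminus_gt0 (x : V) (r : nat) : d x = r.+1 -> 0 < kminus G x0 x.
Proof.
move=> dx; rewrite -(pmulr_rgt0 _ (gm_gt0 G x)).
rewrite (@gm_kminus _ (nbrs x)) ?fset_uniq// big_mkcond.
have [y yx dy] := dist_pred dx; rewrite adj_sym in yx.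
rewrite (bigD1_seq y) ?fset_uniq ?in_nbrs//= dy dx eqxx ltr_wpDr//.
  by apply: sumr_ge0 => z _; case: ifP => // _; exact: gb_ge0.
by rewrite lt_def gb_ge0 andbT.
Qed.

(** * Averages over the spheres of a model *)

Definition sphere_avg (f : V -> R) (r : nat) : R :=
  sphere_sum (fun x => f x * gm G x) r / sphere_sum (gm G) r.

Lemma le_ball_sum (F : V -> R) (m n : nat) : (forall x, 0 <= F x) ->
  (m <= n)%N -> \sum_(x <- ball m) F x <= \sum_(x <- ball n) F x.
Proof.
move=> F0 /subnK <-; elim: (n - m)%N => [|k ih]; first by rewrite add0n.
apply: (le_trans ih).
by rewrite addSn ball_sumS lerDl; apply: sumr_ge0.
Qed.

Section Model.
Variables kp km : nat -> R.
Hypothesis model : is_model G x0 kp km.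
Hypothesis spheres : forall r, sphere G x0 r !=set0.

Local Notation M := (sphere_sum (gm G)).

Let M_gt0 (r : nat) : 0 < M r.
Proof. by apply: sphere_sum_gt0 => // x; exact: gm_gt0. Qed.

Lemma sphere_avgK (f : V -> R) (r : nat) :
  sphere_avg f r * M r = sphere_sum (fun x => f x * gm G x) r.
Proof. by rewrite divfK// gt_eqF. Qed.

Lemma sphere_avg_ge0 (f : V -> R) (r : nat) :
  (forall x, 0 <= f x) -> 0 <= sphere_avg f r.
Proof.
move=> f0; rewrite divr_ge0 ?(ltW (M_gt0 r))//.
by apply: sumr_ge0 => x _; rewrite mulr_ge0// ltW ?gm_gt0.
Qed.

Lemma sphere_avg_eq (f : V -> R) (c : R) (r : nat) :
  (forall x, d x = r -> f x = c) -> sphere_avg f r = c.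
Proof.
move=> fc; apply: (mulIf (lt0r_neq0 (M_gt0 r))).
rewrite sphere_avgK -sphere_sumM.
by apply: eq_sphere_sum => x /fc ->.
Qed.

Lemma sphere_avg0 (f : V -> R) : sphere_avg f 0 = f x0.
Proof.
apply: sphere_avg_eq => x dx; congr f.
by have [s [/eqP]] := dist_joined x0 x; rewrite dx size_eq0 => /eqP -> _ <-.
Qed.

(** Equality case of averaging: the nonnegative terms of [h] have sum zero on the sphere, and masses
    are positive. *)
Lemma le_sphere_avg_eq (f g : V -> R) (r : nat) (x : V) :
    (forall y, d y = r -> f y <= g y) -> sphere_avg g r <= sphere_avg f r ->
  d x = r -> f x = g x.
Proof.
move=> le_fg le_avg dx; pose h y := (g y - f y) * gm G y.
have h0 y : d y = r -> 0 <= h y.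
  by move=> dy; rewrite mulr_ge0 ?subr_ge0 ?le_fg// ltW ?gm_gt0.
have sum0 : sphere_sum h r = 0.
  apply/eqP; rewrite eq_le; apply/andP; split; last first.
    by apply: sumr_ge0 => y /eqP; exact: h0.
  rewrite -(ler_pM2r (M_gt0 r)) !sphere_avgK -subr_le0 in le_avg.
  rewrite -mulN1r -sphere_sumM -sphere_sumD in le_avg; apply: le_trans le_avg.
  by apply: le_sphere_sum => y _; rewrite /h; lra.
have : all (fun y => (d y == r) ==> (h y == 0)) (ball r).
  by rewrite -psumr_eq0 => [|y /eqP]; [apply/eqP; exact: sum0|exact: h0].
move=> /allP/(_ x); rewrite in_ball dx leqnn eqxx => /(_ isT)/=.
by rewrite mulf_eq0 (gt_eqF (gm_gt0 G x)) orbF subr_eq0 => /eqP.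
Qed.

(** Both sides are the total weight of the edges between two consecutive spheres. The proof tests
    [ball_laplacian] on the constant 1, whose Laplacian vanishes. *)
Lemma model_balance (r : nat) : kp r * M r = km r.+1 * M r.+1.
Proof.
apply/eqP; rewrite -subr_eq0; apply/eqP.
have := ball_laplacian (fun=> 1) r model.
rewrite big1 => [|x _]; last first.
  rewrite (@gm_laplacian _ _ (nbrs x)) ?fset_uniq// big1// => y _.
  by rewrite subrr mulr0.
have M1 n : sphere_sum (fun x => 1 * gm G x) n = M n.
  by apply: eq_sphere_sum => x _; rewrite mul1r.
by rewrite !M1.
Qed.

Lemma model_km_gt0 (r : nat) : 0 < km r.+1.
Proof.
have [x dx] := spheres r.+1; have [_ <-] := model dx.
exact: kminus_gt0 dx.
Qed.

Lemma model_kp_gt0 (r : nat) : 0 < kp r.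
Proof.
by rewrite -(pmulr_lgt0 _ (M_gt0 r)) model_balance mulr_gt0 ?model_km_gt0.
Qed.

(** Divergence theorem: [model_balance] makes the two coefficients in [ball_laplacian] equal, so
    only the drop of the average remains. *)
Lemma ball_laplacian_avg (f : V -> R) (r : nat) :
  \sum_(x <- ball r) gm G x * laplacian G f x =
  kp r * M r * (sphere_avg f r - sphere_avg f r.+1).
Proof.
rewrite (ball_laplacian f r model) mulrBr {2}model_balance.
by rewrite -!mulrA ![M _ * _]mulrC !sphere_avgK.
Qed.

Section Superharmonic.
Variable f : V -> R.
Hypothesis f_super : forall x, 0 <= laplacian G f x.

Let gm_lap_ge0 (x : V) : 0 <= gm G x * laplacian G f x.
Proof. by rewrite mulr_ge0// ltW ?gm_gt0. Qed.

(** After multiplication by [M r.+1], the two sides are the sums of [gm G x * laplacian G f x] over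
    consecutive balls, and the terms are nonnegative. *)
Lemma sphere_avg_step (r : nat) :
  km r.+1 * (sphere_avg f r - sphere_avg f r.+1) <=
  kp r.+1 * (sphere_avg f r.+1 - sphere_avg f r.+2).
Proof.
rewrite -(ler_pM2r (M_gt0 r.+1)) mulrAC -model_balance [leRHS]mulrAC.
rewrite -!ball_laplacian_avg.
exact: le_ball_sum.
Qed.

Lemma sphere_avg_nonincr (m n : nat) :
  (m <= n)%N -> sphere_avg f n <= sphere_avg f m.
Proof.
move=> /subnK <-; elim: (n - m)%N => [|k ih]; first by rewrite add0n.
apply: le_trans ih; rewrite addSn -subr_ge0.
have kM0 : 0 < kp (k + m)%N * M (k + m)%N by rewrite mulr_gt0 ?model_kp_gt0.
by rewrite -(pmulr_rge0 _ kM0) -ball_laplacian_avg sumr_ge0.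
Qed.

(** Since curvatures are positive, [sphere_avg_step] carries a strict drop from each radius to the
    next. *)
Lemma sphere_avg_decr (m n : nat) : (m <= n)%N ->
  sphere_avg f m.+1 < sphere_avg f m -> sphere_avg f n.+1 < sphere_avg f n.
Proof.
move=> /subnK <- fm; elim: (n - m)%N => [|k ih]; first by rewrite add0n.
rewrite addSn -subr_gt0 -(pmulr_rgt0 _ (model_kp_gt0 (k + m).+1)).
apply: lt_le_trans (sphere_avg_step _).
by rewrite mulr_gt0 ?model_km_gt0// subr_gt0.
Qed.

End Superharmonic.

(* If the averages of min (f, f x0) are constant, then f >= f x0; since the
   averages of f are at most f x0, equality holds everywhere. *)
Lemma sphere_avg_min_decr (f : V -> R) (y : V) :
    (forall x, 0 <= laplacian G f x) -> f y != f x0 ->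
  exists r, sphere_avg (fun x => Num.min (f x) (f x0)) r.+1 <
            sphere_avg (fun x => Num.min (f x) (f x0)) r.
Proof.
move=> f_super; set v := fun x => Num.min (f x) (f x0).
have v_super x : 0 <= laplacian G v x by exact: laplacian_min.
apply: contraNP => no_r; apply/eqP.
have v_avg r : sphere_avg v r = f x0.
  elim: r => [|r ih]; first by rewrite sphere_avg0 /v minxx.
  apply/eqP; rewrite eq_le -{1}ih sphere_avg_nonincr//=.
  by rewrite -ih leNgt; apply/negP => lt_r; apply: no_r; exists r.
have le_f x : f x0 <= f x.
  have <- : v x = f x0; last by rewrite ge_min lexx.
  apply: (@le_sphere_avg_eq v (fun=> f x0) (d x)) => //.
    by move=> z _; rewrite ge_min lexx orbT.
  by rewrite v_avg (@sphere_avg_eq (fun=> f x0) (f x0)).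
apply/esym/(@le_sphere_avg_eq (fun=> f x0) f (d y)) => //.
rewrite (@sphere_avg_eq (fun=> f x0) (f x0))// -(sphere_avg0 f).
exact: sphere_avg_nonincr.
Qed.

End Model.

End Graph.

(** * Transplanting the averages from [Gt] to [G] *)

Theorem theorem4p2 (R : realType)
  (V : choiceType) (G : wgraph R V) (x0 : V)
  (Vt : choiceType) (Gt : wgraph R Vt) (o : Vt) (kp km : nat -> R)
  (V_infinite : infinite_set [set: V])
  (Gt_model : is_model Gt o kp km)
  (G_stronger : stronger_curvature_growth G x0 kp km)
  (C : R) (C_gt0 : 0 < C)
  (G_mass : exists r1 : nat, forall r, (r1 <= r)%N ->
    (gmeas G (sphere G x0 r) <= C%:E * gmeas Gt (sphere Gt o r))%E)
  (Gt_not_Liouville : ~ L1_Liouville Gt) :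
  ~ L1_Liouville G.
Proof.
move=> G_Liouville; apply: Gt_not_Liouville => u u_ge0 u_L1 u_super.
exists (u o) => y; apply/eqP; apply: contrapT => /negP uy.
case: G_stronger => r0 curv; case: G_mass => r1 mass.
have massR r : (r1 <= r)%N ->
    sphere_sum G x0 (gm G) r <= C * sphere_sum Gt o (gm Gt) r.
  by move=> /mass; rewrite !gmeas_sphere -EFinM lee_fin.
(* [G] is infinite, so its spheres have positive mass; the mass comparison then forbids empty
   spheres of [Gt] beyond [r1], and smaller radii follow. *)
have spheres r : sphere Gt o r !=set0.
  apply: (@sphere_le _ _ _ _ _ (maxn r r1)); first exact: leq_maxl.
  apply: contrapT => empty.
  have := massR _ (leq_maxr r r1); apply/negP; rewrite -ltNge.
  rewrite [X in C * X]/sphere_sum big1 ?mulr0; last first.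
    by move=> x /eqP dx; case: empty; exists x.
  by apply: sphere_sum_gt0; [exact: gm_gt0|exact: infinite_sphere].
(* A nonconstant harmonic function has constant averages, so those of [u] itself need not drop; the
   truncation forces a drop. *)
pose v x := Num.min (u x) (u o); pose rho := sphere_avg Gt o v.
have v_ge0 x : 0 <= v x by rewrite le_min !u_ge0.
have v_super x : 0 <= laplacian Gt v x by exact: laplacian_min.
have rho_ge0 r : 0 <= rho r by exact: sphere_avg_ge0.
have [K v_le_K] : exists K, forall n,
    \sum_(x <- ball Gt o n) v x * gm Gt x <= K.
  have [K u_le_K] := (in_L1P Gt o u_ge0).1 u_L1; exists K => n.
  apply: le_trans (u_le_K n); apply: ler_sum => x _.
  by rewrite ler_wpM2r ?(ltW (gm_gt0 _ _))// ge_min lexx.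
have [r2 rho_r2] := sphere_avg_min_decr Gt_model spheres u_super uy.
(* Beyond [N] the curvature comparison, the mass comparison and the strict decrease of [rho] all
   hold. *)
pose N := maxn (maxn r0 r1) r2.
have N_r0 : (r0 <= N)%N by rewrite !leq_max leqnn.
have N_r1 : (r1 <= N)%N by rewrite !leq_max leqnn orbT.
have N_r2 : (r2 <= N)%N by rewrite !leq_max leqnn orbT.
have rho_decr n : (N <= n)%N -> rho n.+1 < rho n.
  move=> Nn; apply: (sphere_avg_decr Gt_model spheres v_super) rho_r2.
  exact: leq_trans Nn.
pose phi n := rho (maxn n N); pose w := phi \o dist G x0.
have w_ge0 x : 0 <= w x by exact: rho_ge0.
have w_super x : 0 <= laplacian G w x.
  rewrite laplacian_radial; have := curv _ x _ (erefl (dist G x0 x)).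
  case: (ltngtP N (dist G x0 x)) => [|dN _|<- _].
  (* Outside: both drops of [rho] are positive, [kplus] is at least [kp] on the outward drop and
     [kminus] at most [km] on the inward one, so [sphere_avg_step] suffices. *)
  - case: (dist G x0 x) => // r; rewrite ltnS => Nr.
    move=> /(_ (leq_trans N_r0 (leqW Nr)))[le_kp le_km].
    have Nr1 := leqW Nr; rewrite /phi/= (maxn_idPl Nr) (maxn_idPl Nr1).
    rewrite (maxn_idPl (leqW Nr1)).
    have := sphere_avg_step Gt_model spheres v_super r.
    have := rho_decr _ (leqW Nr); have := rho_decr _ Nr.
    rewrite -/rho; nra.
  (* Strictly inside, [w] equals [rho N] at [x] and at all its neighbours. *)
  - rewrite /phi (maxn_idPr (ltnW dN)) (maxn_idPr dN).
    rewrite (maxn_idPr (leq_trans (leq_pred _) (ltnW dN))).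
    by rewrite subrr !mulr0 addr0.
  (* At distance exactly [N] the inner difference vanishes, and only the outward drop counts. *)
  - rewrite /phi maxnn (maxn_idPl (leqnSn N)) (maxn_idPr (leq_pred N)).
    by rewrite subrr mulr0 addr0 mulr_ge0 ?kplus_ge0// subr_ge0 ltW// rho_decr.
(* The ball of radius [N] is kept apart because masses are compared only at large radii. Each
   further sphere adds [rho] times its mass in [G], at most [C] times the sum of [v] against [gm Gt]
   over the sphere of [Gt]. *)
have w_ball k : \sum_(x <- ball G x0 (k + N)) w x * gm G x <=
    \sum_(x <- ball G x0 N) w x * gm G x +
    C * \sum_(x <- ball Gt o (k + N)) v x * gm Gt x.
  elim: k => [|k ih].
    rewrite add0n lerDl mulr_ge0 ?(ltW C_gt0)// sumr_ge0// => x _.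
    by rewrite mulr_ge0// ltW ?gm_gt0.
  rewrite addSn !ball_sumS mulrDr addrA lerD//.
  rewrite -(sphere_avgK spheres) -/rho mulrCA.
  pose F x := rho (k + N).+1 * gm G x.
  rewrite (@eq_sphere_sum _ _ _ _ _ F); last first.
    move=> x dx; rewrite /w/= dx /phi.
    by rewrite (maxn_idPl (leqW (leq_addl k N))).
  rewrite /F sphere_sumM ler_wpM2l// massR//.
  by rewrite leqW// (leq_trans N_r1)// leq_addl.
have w_L1 : in_L1 G w.
  apply/(in_L1P G x0 w_ge0).
  exists (\sum_(x <- ball G x0 N) w x * gm G x + C * K) => n.
  apply: le_trans (@le_ball_sum _ _ G x0 _ _ _ _ (leq_addr N n)) _.
    by move=> x; rewrite mulr_ge0// ltW ?gm_gt0.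
  apply: (le_trans (w_ball n)); rewrite lerD2l.
  by rewrite ler_wpM2l ?(ltW C_gt0)//; exact: v_le_K.
have [c w_c] := G_Liouville w w_ge0 w_L1 w_super.
(* Vertices at distances [N] and [N.+1] exist, and [w] takes distinct values there. *)
have [x dx] := infinite_sphere G x0 N V_infinite.
have [x' dx'] := infinite_sphere G x0 N.+1 V_infinite.
have := rho_decr _ (leqnn N).
have -> : rho N = w x by rewrite /w/= dx /phi maxnn.
have -> : rho N.+1 = w x' by rewrite /w/= dx' /phi (maxn_idPl (leqnSn N)).
by rewrite !w_c ltxx.
Qed.
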